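(* Let $\mathbf{F}$ be a finite field with $q$ elements, let $n \ge 1$, let $k$ be a field in which $q$ is nonzero, and let $0 \le r \le n-1$. Define \[ \eta_r \;=\; q^{-(n-1)r}\,\mu(r)\sum_{m} \mu(\mathrm{srk}\, m)\,\binom{n-1-\operatorname{rank} m}{r-\operatorname{rank} m}_{q}\,[m]\ \in k[\mathfrak{M}_n], \] where the sum runs over all semi-idempotent matrices $m\in\mathfrak{M}_n$ with $\operatorname{rank} m\le r$. Then $\eta_r$ is the unit (two-sided identity element) of the ideal $\mathfrak{a}_{n,r}$.
   Context: $\mathfrak{M}_n$ is the monoid of $n\times n$ matrices over $\mathbf{F}$ under multiplication, and $k[\mathfrak{M}_n]$ its monoid algebra over $k$ with basis $\{[m] : m\in\mathfrak{M}_n\}$ and $[m][m']=[mm']$. $\mathfrak{a}_{n,r}$ is the two-sided ideal of $k[\mathfrak{M}_n]$ spanned by $[m]$ with $\operatorname{rank} m \le r$. A matrix (or linear operator $T$ on a finite-dimensional $\mathbf{F}$-space $V$) is semi-idempotent if there is a decomposition $V=X\oplus Y$ into $T$-stable subspaces with $T|_X$ the identity and $T|_Y$ nilpotent (equivalently, $T$ acts as the identity on $\operatorname{im} T^N$ for $N\gg0$). The stable rank $\mathrm{srk}\, m$ is the rank of $m^i$ for $i\gg 0$. $\mu(i)=(-1)^i q^{\binom{i}{2}}$. The $q$-binomial coefficient is $\binom{a}{b}_q=\frac{[a]_q!}{[b]_q![a-b]_q!}$ with $[a]_q!=\prod_{i=1}^a \frac{q^i-1}{q-1}$. *)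

(* Defs.v *)
From HB Require Import structures.
From mathcomp Require Import all_boot all_order all_algebra.
From mathcomp Require Import boolp.
Set Implicit Arguments. Unset Strict Implicit. Unset Printing Implicit Defensive.
Import Order.TTheory GRing.Theory Num.Theory.
Local Open Scope ring_scope.

(* Matrices are n'.+1 x n'.+1 (so n = n'.+1 >= 1); a matrix m acts on row
   vectors v |-> v *m m, and subspaces of F^n are row spaces (mxalgebra). *)

(* The monoid algebra k[M_n]: finitely supported (here: all) functions
   M_n -> k, with basis [m] and convolution product [m][m'] = [m m']. *)
Notation malg k F n' := {ffun 'M[F]_n'.+1 -> GRing.Field.sort k}.

Definition mbasis (k : fieldType) (F : finFieldType) (n' : nat)
  (m : 'M[F]_n'.+1) : malg k F n' := [ffun x => (x == m)%:R].

Definition malg_mul (k : fieldType) (F : finFieldType) (n' : nat)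
  (a b : malg k F n') : malg k F n' :=
  [ffun m => \sum_(p : 'M[F]_n'.+1 * 'M[F]_n'.+1 | p.1 *m p.2 == m) a p.1 * b p.2].

(* membership in the ideal a_{n,r} = span{[m] : rank m <= r} *)
Definition in_ideal (k : fieldType) (F : finFieldType) (n' r : nat)
  (x : malg k F n') : Prop :=
  forall m : 'M[F]_n'.+1, (r < \rank m)%N -> x m = 0.

Definition semi_idempotent (F : finFieldType) (n' : nat) (m : 'M[F]_n'.+1) : Prop :=
  exists X Y : 'M[F]_n'.+1,
    [/\ (X + Y == 1%:M)%MS /\ mxdirect (X + Y),
        (X *m m <= X)%MS, (Y *m m <= Y)%MS,
        X *m m = X & (exists N : nat, Y *m m ^+ N = 0)].

(* stable rank: rank of m^i for i >> 0; the rank sequence is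
   non-increasing, so this is its minimum, attained for all i >= n *)
Definition srk (F : finFieldType) (n' : nat) (m : 'M[F]_n'.+1) : nat :=
  \rank (m ^+ n'.+1).

Definition mu (k : fieldType) (q i : nat) : k :=
  (-1) ^+ i * (q%:R) ^+ 'C(i, 2).

Definition qint (q i : nat) : nat := \sum_(j < i) q ^ j.
Definition qfact (q a : nat) : nat := \prod_(1 <= i < a.+1) qint q i.
Definition qbinom (q a b : nat) : nat :=
  qfact q a %/ (qfact q b * qfact q (a - b)).

Definition eta_r (k : fieldType) (F : finFieldType) (n' r : nat) : malg k F n' :=
  let q := #|F| in
  [ffun x => ((q%:R : k) ^+ (n' * r))^-1 * mu k q r *
    \sum_(m : 'M[F]_n'.+1 | `[< semi_idempotent m >] && (\rank m <= r)%N)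
       (mu k q (srk m) * (qbinom q (n' - \rank m) (r - \rank m))%:R)
         * mbasis k m x].

(* Main.v *)
Require Import Defs.
From HB Require Import structures.
From mathcomp Require Import all_boot all_order all_algebra.
From mathcomp Require Import mxabelem boolp.
From mathcomp Require Import zify ring.
Import GRing.Theory Num.Theory.
Local Open Scope ring_scope.
Set Implicit Arguments.
Unset Strict Implicit.
Unset Printing Implicit Defensive.

(** Give a semi-idempotent [t] the weight mu (srk t) and any other matrix the
    weight 0.  The key fact is that the weights sum to 0 along every line
    { t + c b : c a column } with a fixed row b <> 0.  It follows by induction
    on the size, because [a *m u] and [u *m a] have the same weight: either the
    line factors through a smaller size, or we may assume v t = 0 with v <> 0
    and split according to whether v c = 0 (the matrices with v c = 0 factor
    through the rank of t, and those with v c <> 0 are invertible, so only the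
    identity counts).

    Consequently the sum over { m : m x = y } of weight(m) Q^e, where
    Q = q^(n - rank m) counts the columns killed by m, vanishes as soon as
    rank x + e < n.  Since the q-binomial [n - rank m, s - rank m] is a
    polynomial in Q of degree n - s, the element
    zeta_s = q^(-(n-1)s) mu(s) sum_m weight(m) [n - rank m, s - rank m] [m]
    satisfies zeta_s [x] = 0 whenever rank x < s.  The q-Pascal rule gives
    eta_s - eta_(s-1) = zeta_s and 1 - eta_(n-1) = zeta_n, so that
    (1 - eta_r) [x] = (zeta_(r+1) + ... + zeta_n) [x] = 0 when rank x <= r.
    The other side follows by transposition. *)

(* Average over the translations: every point is hit equally often. *)
Lemma sum_translate0 (T : finZmodType) (C : finType) (g : C -> T)
    (P : pred T) (f : T -> int) :
    (0 < #|C|)%N -> (forall x c, P (x + g c) = P x) ->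
    (forall x, P x -> \sum_c f (x + g c) = 0) ->
  \sum_(x | P x) f x = 0.
Proof.
move=> C_gt0 Pg f0; apply/eqP.
suff: (\sum_(x | P x) f x) *+ #|C| == 0.
  by rewrite -mulr_natr mulf_eq0 pnatr_eq0 -leqn0 leqNgt C_gt0 orbF.
have E c : \sum_(x | P x) f x = \sum_(x | P x) f (x + g c).
  rewrite (reindex_inj (addIr (g c))) /=.
  by apply: eq_bigl => x; rewrite Pg.
rewrite -sumr_const (eq_bigr _ (fun c _ => E c)) exchange_big /=.
by apply/eqP; apply: big1.
Qed.

(** * Powers of a matrix and their stable row space *)

Section Stabilisation.

Variables (F : fieldType) (n : nat).
Implicit Type t : 'M[F]_n.

Lemma expmx_sub t k l : (k <= l)%N -> (t ^+ l <= t ^+ k)%MS.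
Proof. by move=> /subnK <-; rewrite exprD submxMl. Qed.

Lemma expmx_stable t l : (t ^+ n <= t ^+ (n + l))%MS.
Proof.
have step k : (t ^+ k <= t ^+ k.+1)%MS -> (t ^+ k.+1 <= t ^+ k.+2)%MS.
  by move=> h; rewrite (exprSr t k.+1) {1}(exprSr t k) submxMr.
(* Until the row spaces of the powers stabilise, each step loses rank, which can happen at most n
   times. *)
have h k : (t ^+ k <= t ^+ k.+1)%MS || (\rank (t ^+ k) <= n - k)%N.
  elim: k => [|k IH]; first by rewrite subn0 rank_leq_col orbT.
  have [le|nle] := boolP (t ^+ k <= t ^+ k.+1)%MS; first by rewrite step.
  rewrite (negPf nle) /= in IH; apply/orP; right.
  have lt : (\rank (t ^+ k.+1) < \rank (t ^+ k))%N.
    by rewrite (ltn_leqif (mxrank_leqif_sup (expmx_sub t (leqnSn k)))) nle.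
  by rewrite subnS; move: (leq_trans lt IH); case: (n - k)%N.
have hn : (t ^+ n <= t ^+ n.+1)%MS.
  have /orP[//|] := h n.
  by rewrite subnn leqn0 mxrank_eq0 => /eqP ->; rewrite sub0mx.
have hl k : (t ^+ (n + k) <= t ^+ (n + k).+1)%MS.
  by elim: k => [|k IH]; rewrite ?addn0 // addnS step.
elim: l => [|l IH]; first by rewrite addn0.
by rewrite addnS (submx_trans IH).
Qed.

Lemma rank_expmx_stable t k : (n <= k)%N -> \rank (t ^+ k) = \rank (t ^+ n).
Proof.
move=> le; apply/eqP; rewrite eqn_leq mxrankS ?expmx_sub //= mxrankS //.
by rewrite -(subnKC le) expmx_stable.
Qed.

(* The exponent [n] stands for any large one: see [rank_expmx_stable]. *)
Definition semi_idemb t := t ^+ n.+1 == t ^+ n.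

(** By stability [t ^+ n] is a left multiple of [t ^+ (n + k)], which right multiplication by [t]
    fixes. *)
Lemma semi_idemb_exp t k : t ^+ k.+1 = t ^+ k -> semi_idemb t.
Proof.
move=> h; have /submxP[w e] := expmx_stable t k.
rewrite /semi_idemb; have hk : t ^+ (n + k).+1 = t ^+ (n + k) by rewrite -addnS !exprD h.
have -> : t ^+ n.+1 = w *m (t ^+ (n + k) *m t) by rewrite mulmxA -e exprSr.
have -> : t ^+ (n + k) *m t = t ^+ (n + k) by rewrite -[RHS]hk exprSr.
by rewrite -e.
Qed.

Lemma exp_semi_idemb t k : semi_idemb t -> (n <= k)%N -> t ^+ k.+1 = t ^+ k.
Proof.
by move=> /eqP h /subnKC <-; rewrite -addSn !exprD h.
Qed.

Lemma semi_idemb_unit t : t \in unitmx -> semi_idemb t = (t == 1).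
Proof.
move=> u; apply/eqP/eqP => [h|->]; last by rewrite !expr1n.
have un k : t ^+ k \in unitmx.
  by elim: k => [|k IH]; rewrite ?expr0 ?unitmx1 // exprS unitmx_mul u.
have e : t ^+ n *m t = t ^+ n by rewrite -[RHS]h exprSr.
by rewrite -[LHS](mulKmx (un n)) e mulVmx.
Qed.

Lemma trmx_exp t k : t^T ^+ k = (t ^+ k)^T.
Proof.
elim: k => [|k IH]; first by rewrite !expr0 trmx1.
by rewrite exprS exprSr IH -mulmxE trmx_mul.
Qed.

Lemma semi_idemb_tr t : semi_idemb t^T = semi_idemb t.
Proof. by rewrite /semi_idemb !trmx_exp (inj_eq (can_inj (@trmxK _ _ _))). Qed.

End Stabilisation.

(* The weights are integers, not elements of [k], so that factors such as q^i - 1,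
   which may vanish in [k], can be cancelled from counting identities. *)
Definition mu_int (F : finFieldType) (i : nat) : int :=
  (-1) ^+ i * (#|F|%:R) ^+ 'C(i, 2).

Definition srk_weight (F : finFieldType) (n : nat) (t : 'M[F]_n) : int :=
  if semi_idemb t then mu_int F (\rank (t ^+ n)) else 0.

Lemma mu_intS (F : finFieldType) i : mu_int F i.+1 = - (#|F|%:R ^+ i * mu_int F i).
Proof. by rewrite /mu_int binS bin1 exprD exprS; ring. Qed.

(** * Symmetries of the weight *)

Section Weight.
Variable F : finFieldType.

Lemma srk_weight_unit n (t : 'M[F]_n) : t \in unitmx ->
  srk_weight t = if t == 1 then mu_int F n else 0.
Proof.
move=> u; rewrite /srk_weight semi_idemb_unit //; case: eqP => // ->.
by rewrite expr1n mxrank1.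
Qed.

Lemma srk_weight_tr n (t : 'M[F]_n) : srk_weight t^T = srk_weight t.
Proof. by rewrite /srk_weight semi_idemb_tr trmx_exp mxrank_tr. Qed.

(** Since (x y)^(k+1) = x (y x)^k y, a stable power of one product yields one of the other, and each
    stable rank bounds the other. *)
Lemma srk_weight_mulC n r (a : 'M[F]_(n, r)) (u : 'M[F]_(r, n)) :
  srk_weight (a *m u) = srk_weight (u *m a).
Proof.
have E m p (x : 'M[F]_(m, p)) (y : 'M[F]_(p, m)) k :
    (x *m y) ^+ k.+1 = x *m (y *m x) ^+ k *m y.
  elim: k => [|k IH]; first by rewrite expr1 expr0 mulmx1.
  by rewrite exprS IH exprS -!mulmxE !mulmxA.
have S m p (x : 'M[F]_(m, p)) (y : 'M[F]_(p, m)) :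
    semi_idemb (y *m x) -> semi_idemb (x *m y).
  by move=> h; apply: (@semi_idemb_exp _ _ _ p.+1);
    rewrite (E _ _ x y p.+1) (E _ _ x y p) exp_semi_idemb.
have R m p (x : 'M[F]_(m, p)) (y : 'M[F]_(p, m)) : semi_idemb (y *m x) ->
    (\rank ((x *m y) ^+ m) <= \rank ((y *m x) ^+ p))%N.
  move=> h; rewrite -(@rank_expmx_stable _ _ _ (m + p).+1); last by lia.
  rewrite E -(@rank_expmx_stable _ _ _ (m + p)); last by lia.
  by rewrite (leq_trans (mxrankM_maxl _ _)) ?mxrankM_maxr.
rewrite /srk_weight; case: ifPn => [h|/negPf h].
  have h' := S _ _ _ _ h; rewrite h'; congr mu_int.
  by apply/eqP; rewrite eqn_leq !R.
by case: ifPn => // /S; rewrite h.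
Qed.
End Weight.

(** * Vanishing of the weight along lines *)

Section Line.
Variable F : finFieldType.

Lemma rank_row_neq0 n (v : 'rV[F]_n) : v != 0 -> exists w : 'cV_n, v *m w = 1%:M.
Proof. by move=> v0; apply/row_freeP; rewrite /row_free rank_rV v0. Qed.

(** Here t = a u, v t = 0, and n = r + 1. The half v c = 0 drops to size r with direction b a;
    either it cancels against the identity, or both halves vanish. *)
Lemma srk_weight_line_full n r (a : 'M[F]_(n, r)) (u : 'M[F]_(r, n)) (b v : 'rV[F]_n) :
    row_full a -> row_free u ->
    (forall s (b' : 'rV[F]_r), b' != 0 ->
       \sum_(c : 'cV[F]_r) srk_weight (s + c *m b') = 0) ->
    b != 0 -> v != 0 -> v *m a = 0 -> \rank (col_mx u b) = n ->
  \sum_(c : 'cV[F]_n) srk_weight (a *m u + c *m b) = 0.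
Proof.
move=> afull ufree IH b0 v0 va0 full.
have ra : \rank a = r by apply/eqP.
have ru : \rank u = r by apply/eqP.
have rn : n = r.+1.
  have le1 : (n <= r + 1)%N.
    rewrite -[X in (X <= _)%N]full -addsmxE (leq_trans (mxrank_adds_leqif _ _)) //.
    by rewrite ru leq_add2l rank_leq_row.
  have : (v <= kermx a)%MS by apply/sub_kermxP.
  move/mxrankS; rewrite rank_rV v0 mxrank_ker ra.
  lia.
have [u' uK] : exists u', u *m u' = 1%:M by apply/row_freeP.
have [a' aK] : exists a', a' *m a = 1%:M by apply/row_fullP.
pose t := a *m u.
have vt0 : v *m t = 0 by rewrite mulmxA va0 mul0mx.
have kera (x : 'rV_n) : x *m a = 0 -> exists s, x = s *: v.
  move=> xa0; apply/sub_rVP.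
  have va : (v <= kermx a)%MS by apply/sub_kermxP.
  have h : (kermx a <= v)%MS.
    rewrite -(geq_leqif (mxrank_leqif_sup va)) mxrank_ker ra rank_rV v0.
    by rewrite [X in (X - _)%N]rn subSnn.
  by apply: submx_trans h; apply/sub_kermxP.
(* The rows of 1 - a a' are killed by [a], hence are multiples of [v]; so a a' fixes every column
   with v c = 0. *)
have cola (c : 'cV_n) : v *m c = 0 -> a *m (a' *m c) = c.
  move=> vc0; apply/eqP; rewrite -subr_eq0 -trmx_eq0; apply/eqP.
  have [z zv]: exists z : 'M_(n, 1), 1%:M - a *m a' = z *m v.
    apply/submxP; apply/row_subP => i.
    have /kera[s ->] : row i (1%:M - a *m a') *m a = 0.
      by rewrite -row_mul mulmxBl mul1mx -mulmxA aK mulmx1 subrr row0.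
    by rewrite scalemx_sub.
  have: (1%:M - a *m a') *m c = 0 by rewrite zv -mulmxA vc0 mulmx0.
  by rewrite mulmxBl mul1mx -mulmxA => /eqP; rewrite subr_eq0 => /eqP <-;
    rewrite subrr trmx0.
have singular : \sum_(c : 'cV[F]_n | v *m c == 0) srk_weight (t + c *m b) =
    \sum_(c : 'cV[F]_r) srk_weight (u *m a + c *m (b *m a)).
  rewrite (reindex_onto (fun c => a *m c) (fun c => a' *m c)) /=; last first.
    by move=> c /eqP; apply: cola.
  apply: eq_big => [c|c _].
    by rewrite mulmxA va0 mul0mx eqxx mulmxA aK mul1mx eqxx.
  by rewrite -mulmxA -mulmxDr srk_weight_mulC mulmxDl mulmxA.
have regular (c : 'cV_n) : v *m c != 0 ->
    srk_weight (t + c *m b) = if t + c *m b == 1 then mu_int F n else 0.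
  move=> vc0; apply: srk_weight_unit; rewrite -row_full_unit -sub1mx.
  (* v (t + c b) = (v c) b puts [b] in the row space, hence also [t] and u = a' t; together [u] and
     [b] span. *)
  have bT : (b <= (t + c *m b)%R)%MS.
    have nz : (v *m c) 0 0 != 0.
      by apply: contra vc0 => /eqP h; rewrite [v *m c]mx11_scalar h raddf0.
    rewrite -(eqmx_scale b nz).
    have -> : (v *m c) 0 0 *: b = v *m (t + c *m b).
      by rewrite -mul_scalar_mx -mx11_scalar mulmxDr vt0 add0r mulmxA.
    exact: submxMl.
  have uT : (u <= (t + c *m b)%R)%MS.
    have tT : (t <= (t + c *m b)%R)%MS.
      by rewrite -{1}[t](addrK (c *m b)) addmx_sub ?submx_refl // eqmx_opp mulmx_sub.
    by apply: submx_trans tT; rewrite -[u]mul1mx -aK -mulmxA submxMl.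
  apply: (submx_trans (B := col_mx u b)); last by rewrite -addsmxE addsmx_sub uT.
  by rewrite sub1mx /row_full full.
have a1 (c : 'cV_n) : t + c *m b = 1 -> v = (v *m c) 0 0 *: b.
  move=> h; rewrite -mul_scalar_mx -mx11_scalar -mulmxA.
  by rewrite -{1}[v]mulmx1 -[1%:M]h mulmxDr vt0 add0r.
rewrite (bigID (fun c => v *m c == 0)) /= singular (eq_bigr _ regular).
(* If b a != 0, the identity is not on the line: v = (v c) b and v a = 0 would force v = 0. *)
have [ba0|ba0] := eqVneq (b *m a) 0; last first.
  rewrite IH // add0r big1 // => c _; case: eqP => // /a1 h.
  case/eqP: ba0; move: va0 v0; rewrite {1 2}h -scalemxAl => /eqP.
  by rewrite scaler_eq0 => /orP[/eqP ->|/eqP //]; rewrite scale0r eqxx.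
have [s bv] := kera _ ba0.
have s0 : s != 0 by apply: contraNneq b0 => s0; rewrite bv s0 scale0r.
(* If x u a = 0 then x u = z v; for z != 0 this puts [b], a multiple of [v], in the row space of
   [u], and [u] alone would span. *)
have ua_unit : u *m a \in unitmx.
  rewrite -row_free_unit -kermx_eq0; apply/rowV0P => x /sub_kermxP xua.
  have [z xz] := kera (x *m u) (etrans (esym (mulmxA _ _ _)) xua).
  have [z0|z0] := eqVneq z 0.
    by apply: (row_free_inj ufree); rewrite xz z0 scale0r mul0mx.
  have bu : (b <= u)%MS.
    rewrite bv -[v]scale1r -(mulVf z0) -scalerA -xz !scalemx_sub // submxMl //.
  have : (n <= \rank u)%N.
    by rewrite -[X in (X <= _)%N]full mxrankS // -addsmxE addsmx_sub submx_refl.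
  by rewrite ru rn ltnn.
rewrite [X in X + _](eq_bigr (fun _ => srk_weight (u *m a))) => [|c _]; last first.
  by rewrite ba0 mulmx0 addr0.
rewrite sumr_const card_mx muln1 srk_weight_unit //.
have [ua1|ua1] := eqVneq (u *m a) 1; last first.
  rewrite mul0rn add0r big1 // => c _; case: eqP => // h.
  case/eqP: ua1; apply: (row_full_inj afull).
  by rewrite mulmxA -/t -[t](addrK (c *m b)) h mulmxBl mul1mx -mulmxA ba0 mulmx0
    subr0 mulmx1.
have [z zv] : exists z : 'cV_n, 1 - t = z *m b.
  apply/submxP; apply/row_subP => i.
  have /kera[z ->] : row i (1 - t) *m a = 0.
    by rewrite -row_mul mulmxBl mul1mx -mulmxA ua1 mulmx1 subrr row0.
  by rewrite bv (eqmx_scale _ s0) scalemx_sub.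
have vz : v *m z != 0.
  apply: contraNneq v0 => h.
  by rewrite -[v]mulmx1 -[1%:M](subrK t) mulmxDr vt0 addr0 zv mulmxA h mul0mx.
have [b' bK] := rank_row_neq0 b0.
have tz : t + z *m b = 1 by rewrite -zv addrC subrK.
rewrite (bigD1 z) //= tz eqxx big1 => [|c /andP[_ cz]].
  (* The q^r singular terms mu(r) cancel the identity's mu(r+1) = - q^r mu(r). *)
  by rewrite addr0 -mulr_natl natrX rn mu_intS subrr.
case: eqP => // h; case/eqP: cz.
by rewrite -[c]mulmx1 -[z]mulmx1 -bK !mulmxA -zv -h addrC addKr.
Qed.

(** Swapping the factor [u] turns a shift of the column by u' c into a shift by c d at size r, so
    each coset of the image of [u'] becomes a smaller line. *)
Lemma srk_weight_line_factor n r (a u' : 'M[F]_(n, r)) (u : 'M[F]_(r, n)) (d : 'rV[F]_r)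
    (x : 'cV[F]_n) (c : 'cV[F]_r) : u *m u' = 1%:M ->
  srk_weight (a *m u + (x + u' *m c) *m (d *m u)) =
  srk_weight (u *m a + u *m x *m d + c *m d).
Proof.
move=> uK; rewrite mulmxA -mulmxDl srk_weight_mulC !mulmxDl !mulmxDr !mulmxA uK mul1mx.
by rewrite addrA.
Qed.

Lemma srk_weight_line n (t : 'M[F]_n) (b : 'rV[F]_n) : b != 0 ->
  \sum_(c : 'cV[F]_n) srk_weight (t + c *m b) = 0.
Proof.
elim/ltn_ind: n t b => n IH t b b0.
have [lt|] := boolP (\rank (col_mx t b) < n)%N.
  have [r ltr [u [u' [a [d [tE bE uK]]]]]] : exists2 r, (r < n)%N &
      exists (u : 'M[F]_(r, n)) (u' : 'M[F]_(n, r)) (a : 'M[F]_(n, r)) (d : 'rV[F]_r),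
      [/\ t = a *m u, b = d *m u & u *m u' = 1%:M].
    exists (\rank (col_mx t b)) => //; exists (row_base (col_mx t b)).
    have /row_freeP[u' uK] := row_base_free (col_mx t b).
    have : (col_mx t b <= row_base (col_mx t b))%MS by rewrite eq_row_base.
    by rewrite -addsmxE addsmx_sub => /andP[/submxP[a tE] /submxP[d bE]]; exists u', a, d.
  have d0 : d != 0 by apply: contraNneq b0 => d0; rewrite bE d0 mul0mx.
  apply: (@sum_translate0 _ 'cV[F]_r (fun c => u' *m c) predT) => //.
    by apply/card_gt0P; exists 0.
  move=> x _; rewrite -[RHS](IH _ ltr (u *m a + (u *m x) *m d) d d0).
  apply: eq_bigr => c _; rewrite tE bE.
  exact: srk_weight_line_factor.
rewrite -leqNgt => ge.
(* [cokermx b] has rank n - 1, so some v != 0 has v t = l b. Moving the origin of the line by - l w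
   b, where v w = 1, gives v t' = 0. *)
have /rowV0Pn[v /sub_kermxP vk v0] : kermx (t *m cokermx b) != 0.
  rewrite kermx_eq0 /row_free neq_ltn; apply/orP; left.
  rewrite (leq_ltn_trans (mxrankM_maxr _ _)) // mxrank_coker rank_rV b0 subn1.
  rewrite ltn_predL lt0n; apply: contraNneq b0 => n0.
  by rewrite -mxrank_eq0 -leqn0 -[X in (_ <= X)%N]n0 rank_leq_col.
have /sub_rVP[l vt] : (v *m t <= b)%MS by rewrite submxE -mulmxA vk.
have [w vw] := rank_row_neq0 v0.
set t' := t - (l *: w) *m b.
have vt0 : v *m t' = 0.
  by rewrite mulmxBr vt mulmxA -scalemxAr vw -scalemxAl mul1mx subrr.
rewrite (reindex_inj (addIr (- (l *: w)))) /=.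
rewrite (eq_bigr (fun c => srk_weight (col_base t' *m row_base t' + c *m b))); last first.
  by move=> c _; rewrite mulmx_base mulmxDl mulNmx /t' addrAC addrA.
have rt : (\rank t' < n)%N.
  have : (v <= kermx t')%MS by apply/sub_kermxP.
  move/mxrankS; rewrite rank_rV v0 mxrank_ker /=; lia.
apply: (@srk_weight_line_full _ _ _ _ _ v); rewrite ?col_base_full ?row_base_free //.
- by move=> s b'; apply: IH.
- apply: (row_free_inj (row_base_free t')).
  by rewrite -mulmxA mulmx_base vt0 mul0mx.
- apply/eqP; rewrite eqn_leq rank_leq_col (leq_trans ge) // mxrankS //.
  rewrite -!addsmxE !addsmx_sub addsmxSr andbT.
  rewrite -[X in (X <= _)%MS](subrK ((l *: w) *m b)) -/t' addmx_sub //.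
    by rewrite (submx_trans _ (addsmxSl _ _)) // eq_row_base.
  by rewrite mulmx_sub // addsmxSr.
Qed.
End Line.

(** * Moments of the weight over the solutions of m x = y *)

Section Moments.
Variables (F : finFieldType) (n : nat).

(** The Q of the overview, taken in the integers so that differences Q - q^i can be formed. *)
Definition card_coker (m : 'M[F]_n) : int := (#|F| ^ (n - \rank m))%:R.

Lemma card_cokerE (m : 'M[F]_n) :
  card_coker m = \sum_(v : 'cV[F]_n | m *m v == 0) 1.
Proof.
rewrite sumr_const /card_coker -(mxrank_tr m) -mxrank_ker -card_rowg.
congr (_%:R); rewrite -!sum1_card.
rewrite (reindex (@trmx F n 1)) /=; last by apply: onW_bij; exists trmx; apply: trmxK.
apply: eq_bigl => v; rewrite mem_rowg [RHS](_ : _ = (m *m v == 0)) //.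
apply/sub_kermxP/eqP => h.
  by rewrite -[m *m v]trmxK trmx_mul h trmx0.
by rewrite -trmx_mul h trmx0.
Qed.

(** For e = 0, a row b != 0 with b x = 0 makes the solution set a union of lines. Each further
    factor Q counts columns v with m v = 0; adjoining v to x raises its rank by at most 1. *)
Lemma srk_weight_moment e p (x y : 'M[F]_(n, p)) : (\rank x + e < n)%N ->
  \sum_(m : 'M[F]_n | m *m x == y) srk_weight m * card_coker m ^+ e = 0.
Proof.
elim: e p x y => [|e IH] p x y lt.
  have /rowV0Pn[b /sub_kermxP bx b0] : kermx x != 0.
    by rewrite kermx_eq0 /row_free neq_ltn; rewrite addn0 in lt; rewrite lt.
  apply: (@sum_translate0 _ 'cV[F]_n (fun c => c *m b)) => [|m c|m _].
  - by apply/card_gt0P; exists 0.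
  - by rewrite mulmxDl -mulmxA bx mulmx0 addr0.
  - rewrite -[RHS](srk_weight_line m b0).
    by apply: eq_bigr => c _; rewrite expr0 mulr1.
under eq_bigr => m _ do rewrite exprSr [X in _ ^+ e * X]card_cokerE mulrA mulr_sumr.
rewrite (exchange_big_dep predT) //= big1 // => v _.
rewrite -[RHS](IH _ (row_mx x v) (row_mx y 0)).
  apply: eq_big => [m|m _]; last by rewrite mulr1.
  rewrite mul_mx_row; apply/andP/eqP => [[/eqP -> /eqP ->]//|].
  by move/eq_row_mx => [-> ->]; rewrite !eqxx.
rewrite -mxrank_tr tr_row_mx -addsmxE (leq_ltn_trans _ lt) //.
rewrite addnS -addSn leq_add2r (leq_trans (mxrank_adds_leqif _ _)) //.
by rewrite mxrank_tr -[X in (_ <= X)%N]addn1 leq_add2l rank_leq_row.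
Qed.

Lemma srk_weight_moment_prod (k : nat -> int) d e p (x y : 'M[F]_(n, p)) :
    (\rank x + e + d < n)%N ->
  \sum_(m : 'M[F]_n | m *m x == y)
    srk_weight m * (card_coker m ^+ e * \prod_(i < d) (card_coker m - k i)) = 0.
Proof.
elim: d e => [|d IH] e lt.
  by under eq_bigr do rewrite big_ord0 mulr1; apply: srk_weight_moment;
    rewrite -[e]addn0 addnA.
have E m : srk_weight m * (card_coker m ^+ e * \prod_(i < d.+1) (card_coker m - k i)) =
   srk_weight m * (card_coker m ^+ e.+1 * \prod_(i < d) (card_coker m - k i)) -
   k d * (srk_weight m * (card_coker m ^+ e * \prod_(i < d) (card_coker m - k i))).
  by rewrite big_ord_recr exprS /=; ring.
rewrite (eq_bigr _ (fun m _ => E m)) sumrB -mulr_sumr !IH ?mulr0 ?subr0 //.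
  by rewrite (leq_trans _ lt) // ltnS addnS leqnSn.
by rewrite addnS addSnnS.
Qed.

End Moments.

(** * Arithmetic of q-factorials and q-binomials *)

Section QBinomial.
Variable q : nat.
Hypothesis q_gt1 : (1 < q)%N.

Lemma qintD k d : qint q (k + d) = (qint q d + q ^ d * qint q k)%N.
Proof.
rewrite /qint addnC big_split_ord /= big_distrr /=; congr addn.
by apply: eq_bigr => i _; rewrite expnD.
Qed.

Lemma qint_gt0 k : (0 < qint q k.+1)%N.
Proof. by rewrite /qint big_ord_recl expn0. Qed.

Lemma qint_pred k : ((q - 1) * qint q k)%N = (q ^ k - 1)%N.
Proof. by rewrite !subn1 predn_exp. Qed.

Lemma qfactS a : qfact q a.+1 = (qfact q a * qint q a.+1)%N.
Proof. by rewrite /qfact big_nat_recr. Qed.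

Lemma qfact_gt0 a : (0 < qfact q a)%N.
Proof.
by elim: a => [|a IH]; [rewrite /qfact big_nil | rewrite qfactS muln_gt0 IH qint_gt0].
Qed.

(** Makes the truncated quotient [qbinom] exact; the induction splits [k + d] as [d] + q^d [k]. *)
Lemma qfact_dvd k d : (qfact q k * qfact q d %| qfact q (k + d))%N.
Proof.
have f0 : qfact q 0 = 1%N by rewrite /qfact big_nil.
elim: k d => [|k IHk] d; first by rewrite f0 mul1n.
elim: d => [|d IHd]; first by rewrite f0 muln1 addn0.
rewrite addSn (qfactS (k + d.+1)) -addSn qintD mulnDr dvdn_add //.
  by rewrite (qfactS d) mulnA -addSnnS dvdn_mul.
by rewrite mulnCA dvdn_mull // (qfactS k) mulnAC dvdn_mul.
Qed.

Lemma qbinomE k d :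
  (qbinom q (k + d) k * (qfact q k * qfact q d))%N = qfact q (k + d).
Proof. by rewrite /qbinom addKn divnK // qfact_dvd. Qed.

Lemma qbinom_pascal k d :
  qbinom q (k.+1 + d.+1) k.+1 =
  (qbinom q (k.+1 + d) k.+1 + q ^ d.+1 * qbinom q (k + d.+1) k)%N.
Proof.
apply/eqP; rewrite -(@eqn_pmul2r (qfact q k.+1 * qfact q d.+1)) ?muln_gt0 ?qfact_gt0 //.
apply/eqP; rewrite qbinomE addSn (qfactS (k + d.+1)) -addSn qintD mulnDr mulnDl.
congr addn.
  rewrite -(addSnnS k d) -(qbinomE k.+1 d) (qfactS d); lia.
rewrite -(qbinomE k d.+1) (qfactS k); lia.
Qed.

(** Exhibits the q-binomial as a polynomial of degree d in Q = q^(k + d), up to a constant that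
    depends on d but not on k. *)
Lemma prod_qbinom k d :
  \prod_(i < d) ((q ^ (k + d))%:R - (q ^ i)%:R : int) =
  (\prod_(i < d) (q%:R ^+ i * (q%:R - 1)) * (qfact q d)%:R) * (qbinom q (k + d) k)%:R.
Proof.
apply: (@mulIf _ (qfact q k)%:R); first by rewrite pnatr_eq0 -lt0n qfact_gt0.
rewrite -!mulrA -!natrM; rewrite (_ : (_ * _)%N = qfact q (k + d)); last first.
  by rewrite -(qbinomE k d); lia.
elim: d k => [|d IH] k; first by rewrite !big_ord0 !mul1r addn0.
rewrite !big_ord_recr /=.
(* The last factor turns [k]! into [k+1]!, so the induction passes from k to k + 1. *)
have E : ((q ^ (k + d.+1))%:R - (q ^ d)%:R : int) * (qfact q k)%:R =
    q%:R ^+ d * (q%:R - 1) * (qfact q k.+1)%:R.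
  have h : (q%:R - 1 : int) * (qint q k.+1)%:R = (q ^ k.+1)%:R - 1.
    have q0 : (0 < q)%N by apply: ltnW.
    have -> : (q%:R - 1 : int) = (q - 1)%:R by rewrite natrB.
    by rewrite -natrM qint_pred natrB // expn_gt0 q0.
  rewrite qfactS natrM addnS -addSn expnD natrM -[(q ^ d)%:R in X in _ - X]mul1r.
  rewrite -mulrBl -h natrX; ring.
rewrite -mulrA E -addSnnS mulrCA IH; ring.
Qed.
End QBinomial.

(** For j > s truncated subtraction would make the binomial 1 instead of 0. *)
Definition qweight (q n s j : nat) : nat :=
  if (j <= s)%N then qbinom q (n - j) (s - j) else 0.

Lemma srk_weight_qbinom_sum (F : finFieldType) n s p (x y : 'M[F]_(n, p)) :
    (\rank x < s <= n)%N ->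
  \sum_(m : 'M[F]_n | m *m x == y) srk_weight m * (qweight #|F| n s (\rank m))%:R = 0.
Proof.
move=> /andP[xs sn]; have q_gt1 := card_finRing_gt1 F.
have ltx : (\rank x + 0 + (n - s) < n)%N by lia.
(* Its factors q - 1 and [n - s]! may vanish in the field k, but not in the integers. *)
set C : int := \prod_(i < n - s) (#|F|%:R ^+ i * (#|F|%:R - 1)) * (qfact #|F| (n - s))%:R.
have C0 : C != 0.
  rewrite mulf_neq0 //; last by rewrite pnatr_eq0 -lt0n qfact_gt0.
  apply/prodf_neq0 => i _; rewrite mulf_neq0 ?expf_neq0 ?pnatr_eq0 -?lt0n
    ?(ltnW q_gt1) //.
  by rewrite subr_eq0 pnatr_eq1 neq_ltn q_gt1 orbT.
apply: (mulfI C0); rewrite mulr0 mulr_sumr.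
rewrite -[RHS](srk_weight_moment_prod (fun i => (#|F| ^ i)%:R) y ltx).
apply: eq_bigr => m _; rewrite expr0 mul1r mulrCA; congr (_ * _).
rewrite /qweight /card_coker; case: leqP => ms.
  have -> : (n - \rank m = (s - \rank m) + (n - s))%N by lia.
  by rewrite prod_qbinom.
(* Above rank s, Q is itself one of the roots q^i of the polynomial. *)
have i_lt : (n - \rank m < n - s)%N by have := rank_leq_row m; lia.
by rewrite mulr0 (bigD1 (Ordinal i_lt)) //= subrr mul0r.
Qed.

(** Given a decomposition, m^(N+1) - m^N kills both summands. Conversely e = m^n is an idempotent
    commuting with m, and X, Y are the row spaces of e and 1 - e. *)
Lemma semi_idempotentP (F : finFieldType) n' (m : 'M[F]_n'.+1) :
  semi_idempotent m <-> semi_idemb m.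
Proof.
split=> [[X [Y [[XY _] _ _ XmX [N YmN]]]]|/eqP h].
  have Xm k : X *m m ^+ k = X.
    by elim: k => [|k IH]; rewrite ?expr0 ?mulmx1 // exprS [X *m _]mulmxA XmX.
  apply: (@semi_idemb_exp _ _ _ N); apply/eqP; rewrite -subr_eq0 -submx0.
  have : ((X + Y)%MS <= kermx (m ^+ N.+1 - m ^+ N))%MS.
    rewrite addsmx_sub; apply/andP; split; apply/sub_kermxP; rewrite mulmxBr.
      by rewrite !Xm subrr.
    by rewrite exprSr [Y *m _]mulmxA YmN mul0mx subrr.
  rewrite (eqmxP XY) => /sub_kermxP; rewrite mul1mx => ->; exact: sub0mx.
set e := m ^+ n'.+1.
have em : e * m = e by rewrite -exprSr h.
have me : m * e = e by rewrite -exprS h.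
have emk k : e * m ^+ k = e.
  by elim: k => [|k IH]; rewrite ?expr0 ?mulr1 // exprS mulrA em.
have ee : e * e = e by apply: emk.
exists e, (1 - e); split => //.
- split.
    rewrite /eqmx submx1 /= -[1%:M](subrKC e) addmx_sub ?addsmxSl //.
    by rewrite addsmxSr.
  apply/mxdirect_addsP/eqP; rewrite -submx0; apply/rV_subP => v.
  rewrite sub_capmx => /andP[/submxP[a va] /submxP[b vb]].
  have : v *m e = v by rewrite va -mulmxA [e *m e]ee.
  rewrite {1}vb -mulmxA [(1 - e) *m e]mulrBl mul1r ee subrr mulmx0 => <-.
  exact: sub0mx.
- by rewrite [e *m m]em submx_refl.
- have -> : (1 - e) *m m = m *m (1 - e).
    by rewrite [LHS]mulrBl [RHS]mulrBr em me mul1r mulr1.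
  exact: submxMl.
- by exists n'.+1; rewrite [LHS]mulrBl mul1r ee subrr.
Qed.

Lemma qbinom_0 q a : (1 < q)%N -> qbinom q a 0 = 1%N.
Proof.
move=> q_gt1; rewrite /qbinom subn0 /qfact big_nil mul1n divnn.
by have := qfact_gt0 q a; rewrite /qfact => ->.
Qed.

Lemma qweight_diag q s j : (1 < q)%N -> (j <= s)%N -> qweight q s s j = 1%N.
Proof.
move=> q_gt1 js; rewrite /qweight js /qbinom subnn /qfact big_nil muln1 divnn.
by have := qfact_gt0 q (s - j); rewrite /qfact => ->.
Qed.

(** * Coefficients of eta_r and its action on basis elements of low rank *)

Section Eta.
Variables (F : finFieldType) (k : fieldType) (n' : nat).
Hypothesis q_neq0 : (#|F|%:R : k) != 0.
Local Notation q := #|F|.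
Local Notation n := n'.+1.

Lemma intr_mu_int i : (mu_int F i)%:~R = mu k q i :> k.
Proof. by rewrite /mu_int /mu rmorphM !rmorphXn rmorphN1 rmorph_nat. Qed.

Lemma muS i : mu k q i.+1 = - (q%:R ^+ i * mu k q i).
Proof. by rewrite /mu binS bin1 exprD exprS; ring. Qed.

Lemma eta_rE r (x : 'M[F]_n) : eta_r k F n' r x =
  (q%:R ^+ (n' * r))^-1 * mu k q r * ((srk_weight x)%:~R * (qweight q n' r (\rank x))%:R).
Proof.
rewrite ffunE; congr (_ * _).
under eq_bigr do rewrite ffunE.
rewrite /qweight /srk_weight; have [sx|nsx] := ifPn (semi_idemb x); last first.
  rewrite mul0r big1 // => m /andP[/asboolP/semi_idempotentP sm _].
  by case: eqP => [xm|_]; [rewrite xm sm in nsx | rewrite mulr0].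
rewrite intr_mu_int; case: (leqP (\rank x) r) => [xr|rx].
  rewrite (bigD1 x) /=; last by rewrite xr andbT; apply/asboolP/semi_idempotentP.
  rewrite eqxx mulr1 big1 ?addr0 // => m /andP[_ mx].
  by rewrite eq_sym (negPf mx) mulr0.
rewrite mulr0 big1 // => m /andP[_ mr].
by case: eqP => [xm|_]; [rewrite xm ltnNge mr in rx | rewrite mulr0].
Qed.

(** This is 1 - eta_(n-1) = zeta_n. Below full rank the binomial is 1; among invertible matrices
    only the identity has weight, and its mu(n) cancels the 1. *)
Lemma eta_r_top (x : 'M[F]_n) : eta_r k F n' n' x =
  (x == 1)%:R + (q%:R ^+ (n' * n'))^-1 * mu k q n' * (srk_weight x)%:~R.
Proof.
rewrite eta_rE; have [xn|xn] := leqP (\rank x) n'.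
  have -> : (x == 1) = false.
    by apply: contraTF xn => /eqP ->; rewrite mxrank1 ltnn.
  by rewrite qweight_diag ?card_finRing_gt1 // mulr1 add0r.
have xu : x \in unitmx by rewrite -row_free_unit /row_free eqn_leq rank_leq_row.
rewrite srk_weight_unit // /qweight leqNgt xn mulr0 mulr0.
case: eqP => _; last by rewrite rmorph0 mulr0 add0r.
rewrite intr_mu_int muS.
(* The signs square to 1, and 2 C(n', 2) + n' = n'^2. *)
have e : mu k q n' * mu k q n' * q%:R ^+ n' = q%:R ^+ (n' * n').
  rewrite /mu mulrACA -!exprD addnn -mul2n exprM sqrrN !expr1n mul1r -exprD.
  by congr (_ ^+ _); elim: (n') => // i IH; rewrite binS bin1; nia.
have q1 : q%:R ^+ (n' * n') != 0 :> k by rewrite expf_neq0.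
have -> : (q%:R ^+ (n' * n'))^-1 * mu k q n' * - (q%:R ^+ n' * mu k q n') =
  - (mu k q n' * mu k q n' * q%:R ^+ n') / q%:R ^+ (n' * n') by ring.
by rewrite e mulNr divff // subrr.
Qed.

(** The added term is zeta_(r+1). The q-Pascal rule settles rank x <= r; at rank r + 1 both
    binomials are 1, and above it everything is 0. *)
Lemma eta_r_succ r (x : 'M[F]_n) : (r < n')%N ->
  eta_r k F n' r.+1 x = eta_r k F n' r x +
  (q%:R ^+ (n' * r.+1))^-1 * mu k q r.+1 *
    ((srk_weight x)%:~R * (qweight q n r.+1 (\rank x))%:R).
Proof.
move=> rn; rewrite !eta_rE /qweight; have q_gt1 := card_finRing_gt1 F.
case: (ltngtP (\rank x) r.+1) => [|xr|xr].
- rewrite ltnS => xr; rewrite xr.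
  set i := (r - \rank x)%N; set d := (n' - r.+1)%N.
  have -> : (n' - \rank x = i.+1 + d)%N by lia.
  have -> : (n - \rank x = i.+1 + d.+1)%N by lia.
  have -> : (r.+1 - \rank x = i.+1)%N by lia.
  rewrite qbinom_pascal // muS addSnnS natrD natrM natrX.
  (* The q^r from [muS] and the q^(d+1) from the Pascal rule together absorb one q^n'. *)
  have -> : (n' * r.+1 = n' * r + (r + d.+1))%N by rewrite mulnS; lia.
  have q1 j : q%:R ^+ j != 0 :> k by rewrite expf_neq0.
  by rewrite !exprD; field; rewrite !q1.
- by rewrite (leqNgt _ r) (ltnW xr) /= !mulr0 addr0.
- by rewrite xr ltnn subnn !qbinom_0 // !mulr0 add0r.
Qed.

Lemma srk_weight_sum r (x y : 'M[F]_n) : (\rank x < r <= n)%N ->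
  \sum_(m | m *m x == y) ((srk_weight m)%:~R * (qweight q n r (\rank m))%:R) = 0 :> k.
Proof.
move=> h; rewrite -[RHS](rmorph0 (intmul (1 : k))) -(srk_weight_qbinom_sum y h).
rewrite rmorph_sum.
by apply: eq_bigr => m _; rewrite rmorphM rmorph_nat.
Qed.

(** Compares coefficients of [y] in eta_r [x] = [x]. Descending induction on r: [eta_r_top] starts
    it, and each step removes zeta_(r+1), which kills [x]. *)
Lemma eta_r_mull r (x y : 'M[F]_n) : (r <= n')%N -> (\rank x <= r)%N ->
  \sum_(m | m *m x == y) eta_r k F n' r m = (x == y)%:R.
Proof.
move=> /subnKC; move: (n' - r)%N => d; elim: d r => [|d IH] r.
  rewrite addn0 => -> xr; under eq_bigr do rewrite eta_r_top.
  rewrite big_split /= -mulr_sumr.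
  have := @srk_weight_sum n x y; rewrite ltnS xr leqnn => /(_ isT).
  rewrite [X in X = 0 -> _](eq_bigr (fun m => (srk_weight m)%:~R : k)) => [->|m _];
    last first.
    by rewrite qweight_diag ?mulr1 ?rank_leq_row ?card_finRing_gt1.
  rewrite mulr0 addr0 big_mkcond (bigD1 1) //= mul1mx eqxx big1 ?addr0 => [|m /negPf ->].
    by case: eqP.
  by rewrite if_same.
move=> rd xr; have rn : (r < n')%N by lia.
rewrite -(IH r.+1) ?(leqW xr) -?rd ?addnS //.
rewrite (eq_bigr _ (fun m _ => eta_r_succ m rn)) big_split /= -mulr_sumr.
by rewrite srk_weight_sum ?mulr0 ?addr0 // !ltnS xr ltnW.
Qed.

Lemma eta_r_tr r (x : 'M[F]_n) : eta_r k F n' r x^T = eta_r k F n' r x.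
Proof. by rewrite !eta_rE srk_weight_tr mxrank_tr. Qed.

Lemma eta_r_mulr r (x y : 'M[F]_n) : (r <= n')%N -> (\rank x <= r)%N ->
  \sum_(m | x *m m == y) eta_r k F n' r m = (x == y)%:R.
Proof.
move=> rn xr; rewrite -(inj_eq (can_inj (@trmxK _ _ _))) -(@eta_r_mull r) ?mxrank_tr //.
rewrite (reindex_inj (can_inj (@trmxK _ n n))) /=; apply: eq_big => [m|m _].
  by rewrite -(inj_eq (can_inj (@trmxK _ _ _))) trmx_mul trmxK.
by rewrite eta_r_tr.
Qed.

(** By linearity it is enough that [a] fixes the basis elements [m] in the support of [x]. *)
Lemma malg_mul_left_unit (a x : malg k F n') (P : pred 'M[F]_n) :
    (forall m y, P m -> \sum_(p | p *m m == y) a p = (m == y)%:R) ->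
    (forall m, ~~ P m -> x m = 0) ->
  malg_mul a x = x.
Proof.
move=> ha hx; apply/ffunP => y; rewrite ffunE.
rewrite (eq_bigl (fun p => true && (p.1 *m p.2 == y))) //.
rewrite -(pair_big_dep predT (fun p m => p *m m == y) (fun p m => a p * x m)) /=.
rewrite (exchange_big_dep predT) //= (bigD1 y) //= [X in _ + X]big1 => [|m my].
  rewrite addr0 -mulr_suml; have [Py|/hx ->] := boolP (P y); last by rewrite mulr0.
  by rewrite ha // eqxx mul1r.
rewrite -mulr_suml; have [Pm|/hx ->] := boolP (P m); last by rewrite mulr0.
by rewrite ha // (negPf my) mul0r.
Qed.

Lemma malg_mul_right_unit (a x : malg k F n') (P : pred 'M[F]_n) :
    (forall m y, P m -> \sum_(p | m *m p == y) a p = (m == y)%:R) ->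
    (forall m, ~~ P m -> x m = 0) ->
  malg_mul x a = x.
Proof.
move=> ha hx; apply/ffunP => y; rewrite ffunE.
rewrite (eq_bigl (fun p => true && (p.1 *m p.2 == y))) //.
rewrite -(pair_big_dep predT (fun m p => m *m p == y) (fun m p => x m * a p)) /=.
rewrite (bigD1 y) //= [X in _ + X]big1 => [|m my].
  rewrite addr0 -mulr_sumr; have [Py|/hx ->] := boolP (P y); last by rewrite mul0r.
  by rewrite ha // eqxx mulr1.
rewrite -mulr_sumr; have [Pm|/hx ->] := boolP (P m); last by rewrite mul0r.
by rewrite ha // (negPf my) mulr0.
Qed.
End Eta.

(* n = n'.+1 >= 1; the condition 0 <= r <= n-1 is r <= n'. *)
Theorem theorem4p1 (F : finFieldType) (k : fieldType) (n' r : nat)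
  (hq : (#|F|%:R : k) != 0) (hr : (r <= n')%N) :
  in_ideal r (eta_r k F n' r) /\
  (forall x : malg k F n', in_ideal r x ->
     malg_mul (eta_r k F n' r) x = x /\ malg_mul x (eta_r k F n' r) = x).
Proof.
split=> [m rm|x xr].
  by rewrite eta_rE /qweight leqNgt rm !mulr0.
have x0 m : ~~ (\rank m <= r)%N -> x m = 0 by rewrite -ltnNge; apply: xr.
split.
  by apply: (malg_mul_left_unit (P := fun m => \rank m <= r)%N) => // m y;
    apply: eta_r_mull.
by apply: (malg_mul_right_unit (P := fun m => \rank m <= r)%N) => // m y;
    apply: eta_r_mulr.
Qed.
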